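(* Let $\mathcal{H},\mathcal{K}$ be complex Hilbert spaces, let $m<M$ be real numbers, let $A\in\mathcal{B}(\mathcal{H})$ be a self-adjoint operator with spectrum contained in $[m,M]$, and let $\Phi:\mathcal{B}(\mathcal{H})\to\mathcal{B}(\mathcal{K})$ be a positive unital linear map. Let $t\in(0,1)$ and let $f:[m,M]\to(0,\infty)$ be a continuous function such that $f^t$ is convex. Then for every real number $\alpha$, $$\Phi(f(A))\le\Phi\left(\Big(\frac{M\mathbf{1}_{\mathcal{H}}-A}{M-m}f^t(m)+\frac{A-m\mathbf{1}_{\mathcal{H}}}{M-m}f^t(M)\Big)^{\frac1t}\right)\le\beta\,\mathbf{1}_{\mathcal{K}}+\alpha f(\Phi(A)),$$ where $$\beta=\max_{m\le s\le M}\{a_f s+b_f-\alpha f(s)\},\qquad a_f=\frac{f(M)-f(m)}{M-m},\qquad b_f=\frac{Mf(m)-mf(M)}{M-m}.$$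
   Context: $\mathcal{B}(\mathcal{H})$ is the algebra of bounded linear operators on $\mathcal{H}$ and $\mathbf{1}_{\mathcal{H}}$ is the identity operator. For self-adjoint operators, $X\le Y$ means $Y-X$ is positive, i.e. $\langle Xx,x\rangle\le\langle Yx,x\rangle$ for all $x$. A linear map $\Phi$ is positive if it sends positive operators to positive operators, and unital if $\Phi(\mathbf{1}_{\mathcal{H}})=\mathbf{1}_{\mathcal{K}}$. Functions and powers of self-adjoint operators are defined by the continuous functional calculus; $f^t$ denotes the function $x\mapsto f(x)^t$. *)

(* Defs.v *)
From HB Require Import structures.
From mathcomp Require Import all_boot all_order all_algebra complex.
From mathcomp Require Import all_classical all_reals all_analysis.

Set Implicit Arguments.
Unset Strict Implicit.
Unset Printing Implicit Defensive.

Import Order.TTheory GRing.Theory Num.Theory.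
Import numFieldNormedType.Exports.

Local Open Scope classical_set_scope.
Local Open Scope ring_scope.
Local Open Scope complex_scope.

(* The norm of a normed module over R[i] takes values in R[i].                *)
(* The inner product is linear in its first argument.                         *)
HB.mixin Record CompleteNormedModule_isHilbert (R : realType) H
    of CompleteNormedModule R[i] H := {
  inner : {dot H for (@Num.conj R[i])} ;
  inner_norm : forall x : H, `|x| ^+ 2 = inner x x }.

#[short(type=hilbertType)]
HB.structure Definition Hilbert (R : realType) :=
  {H of CompleteNormedModule R[i] H & CompleteNormedModule_isHilbert R H}.

Definition bounded_linear (R : realType) (H : hilbertType R) : {pred (H -> H)} :=
  mem [set A : H -> H | linear A /\
    exists c : R, forall x, `|A x| <= c%:C * `|x|].

(* bop H is the unital R[i]-algebra B(H), multiplication being composition.   *)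
(* It is only a pzRingType, since 1 = 0 when H is the null space.             *)
Record bop (R : realType) (H : hilbertType R) := Bop {
  bop_fun :> H -> H ;
  bop_funP : bop_fun \in @bounded_linear R H }.

Section BoundedOperators.
Context {R : realType} {H : hilbertType R}.
Implicit Types (A B : bop H) (c : R).

HB.instance Definition _ := [isSub for @bop_fun R H].
HB.instance Definition _ := [Choice of bop H by <:].

Lemma bounded_linear_ge0 (A : H -> H) : A \in @bounded_linear R H ->
  exists2 c : R, 0 <= c & forall x, `|A x| <= c%:C * `|x|.
Proof.
rewrite inE => -[_ [c cA]]; exists `|c| => // x.
by rewrite (le_trans (cA x))// ler_wpM2r// lecR ler_norm.
Qed.

Lemma bounded_linear_submod : submod_closed (@bounded_linear R H).
Proof.
split=> [|a A B bA bB].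
  rewrite inE; split; first by move=> a x y; rewrite scaler0 addr0.
  by exists 0 => x; rewrite normr0 mul0r.
have [c c0 cA] := bounded_linear_ge0 bA.
have [d d0 dB] := bounded_linear_ge0 bB.
move: bA bB; rewrite !inE => -[lA _] [lB _]; split.
  move=> k x y; have E z : (a *: A + B) z = a *: A z + B z by [].
  by rewrite !E lA lB !scalerDr !scalerA (mulrC a k) addrACA.
exists (Normc.normc a * c + d) => x.
rewrite (le_trans (ler_normD _ _))// rmorphD/= mulrDl lerD// normrZ rmorphM/=.
by rewrite -mulrA ler_wpM2l.
Qed.

HB.instance Definition _ :=
  GRing.isSubmodClosed.Build _ _ (@bounded_linear R H) bounded_linear_submod.
HB.instance Definition _ := [SubChoice_isSubLmodule of bop H by <:].

Lemma bop_linear A : linear A.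
Proof. by have := bop_funP A; rewrite inE => -[]. Qed.

HB.instance Definition _ A :=
  GRing.isLinear.Build R[i] H H *:%R A (bop_linear A).

Lemma bounded_linear1 : (id : H -> H) \in @bounded_linear R H.
Proof. by rewrite inE; split=> //; exists 1 => x; rewrite mul1r. Qed.

Lemma bounded_linearM A B : A \o B \in @bounded_linear R H.
Proof.
have [c c0 cA] := bounded_linear_ge0 (bop_funP A).
have [d d0 dB] := bounded_linear_ge0 (bop_funP B).
rewrite inE; split; first by move=> k x y; rewrite /= !linearP.
exists (c * d) => x; rewrite (le_trans (cA _))// rmorphM/= -mulrA.
by rewrite ler_wpM2l// lecR.
Qed.

Definition bop1 : bop H := Bop bounded_linear1.
Definition bop_mul A B : bop H := Bop (bounded_linearM A B).

Lemma bopP A B : A =1 B -> A = B.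
Proof. by move=> AB; apply/val_inj/funext. Qed.

Fact bop_mulA : associative bop_mul. Proof. by move=> A B C; exact: bopP. Qed.
Fact bop_mul1 : left_id bop1 bop_mul. Proof. by move=> A; exact: bopP. Qed.
Fact bop_mulr1 : right_id bop1 bop_mul. Proof. by move=> A; exact: bopP. Qed.
Fact bop_mulDl : left_distributive bop_mul +%R.
Proof. by move=> A B C; exact: bopP. Qed.
Fact bop_mulDr : right_distributive bop_mul +%R.
Proof. by move=> A B C; apply: bopP => x; exact: linearD. Qed.

HB.instance Definition _ := GRing.Zmodule_isPzRing.Build (bop H)
  bop_mulA bop_mul1 bop_mulr1 bop_mulDl bop_mulDr.

Definition self_adjoint A := forall x y, inner (A x) y = inner x (A y).

(* In R[i], 0 <= z means that z is real and nonnegative.                      *)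
Definition op_pos A := forall x, 0 <= inner (A x) x.

Definition op_le A B := op_pos (B - A).

Definition spectrum A : set R[i] :=
  [set z | ~ exists B : bop H,
    (A - z *: (1 : bop H)) * B = 1 /\ B * (A - z *: (1 : bop H)) = 1].

Definition opnorm A : R :=
  inf [set c : R | 0 <= c /\ forall x, `|A x| <= c%:C * `|x|].

Definition op_horner (p : {poly R}) A : bop H :=
  \sum_(i < size p) (p`_i)%:C *: (A ^+ i : bop H).

(* Continuous functional calculus for self-adjoint A and f continuous on the  *)
(* spectrum of A: the norm limit of p_n(A) for real polynomials p_n converging*)
(* to f uniformly on the spectrum. It depends only on the values of f there.  *)
Definition is_fcalc A (f : R -> R) B :=
  exists p : nat -> {poly R},
    {uniform [set s | spectrum A s%:C],
      (fun n s => (p n).[s]) @ \oo --> f} /\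
    opnorm (op_horner (p n) A - B) @[n --> \oo] --> (0 : R).

Definition fcalc (f : R -> R) A : bop H := xget 0 [set B | is_fcalc A f B].

End BoundedOperators.

Section PositiveMaps.
Context {R : realType} {H K : hilbertType R}.

Definition positive_map (Phi : bop H -> bop K) :=
  forall A, op_pos A -> op_pos (Phi A).

Definition unital_map (Phi : bop H -> bop K) := Phi 1 = 1.

End PositiveMaps.

(* The maximum of E when it is attained, and an arbitrary value otherwise.    *)
Definition set_max (R : realType) (E : set R) : R := get (E `&` ubound E).

(* Main.v *)
Require Import Defs.
From HB Require Import structures.
From mathcomp Require Import all_boot all_order all_algebra complex.
From mathcomp Require Import all_classical all_reals all_analysis.
From mathcomp Require Import ring lra.

Set Implicit Arguments.
Unset Strict Implicit.
Unset Printing Implicit Defensive.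

Import Order.TTheory GRing.Theory Num.Theory.
Import numFieldNormedType.Exports.

Local Open Scope classical_set_scope.
Local Open Scope ring_scope.
Local Open Scope complex_scope.

(** The statement is about numbers until the last moment.  Let l be the affine
function that agrees with f^t at m and at M, so that the operator L is l(A),
and let a_f s + b_f be the chord of f.  On [m, M] there are three inequalities
between real numbers:

   - f(s) <= l(s)^(1/t), since f^t is convex and so lies below its chord l
     ([convex_le_chord]);
   - l(s)^(1/t) <= a_f s + b_f, since x |-> x^(1/t) is convex when 1/t >= 1,
     and l(m)^(1/t) = f(m), l(M)^(1/t) = f(M) ([powR_chord]);
   - a_f s + b_f <= beta + alpha f(s), by the choice of beta ([set_max_ge]).

The functional calculus carries an inequality between functions on the
spectrum to one between operators ([fcalc_le]).  The first inequality is used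
at A and then Phi, which preserves the order, is applied.  The second one is
also used at A; applying Phi to it gives a_f Phi(A) + b_f on the right, because
a unital linear map commutes with affine functions.  The third one is used at
Phi(A), whose spectrum is again in [m, M] ([positive_map_spectrum]).

What remains is the functional calculus itself.  Its core is that a real
polynomial that is nonnegative on the spectrum of A gives a positive operator
([op_horner_ge0]).  This rests on two facts about a symmetric operator T.
First, the largest l with T >= l belongs to the spectrum of T, since a positive
invertible operator is bounded below ([spectrum_lower_bound]).  Second, if
p(A) - l is not invertible then, factoring p - l over the complex numbers, one
of its linear factors is not invertible at A, so p takes the value l on the
spectrum ([cop_horner_root]).  Applying positivity to e^2 - p^2 shows that the
size of p(A) is controlled by that of p on the spectrum ([op_horner_bound]);
with Weierstrass approximation ([weierstrass]) and completeness this gives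
existence of f(A) ([fcalc_interval]).  Conversely, bounds on the numerical
range confine the spectrum ([spectrum_bounds]), because an operator that is
coercive is invertible ([coercive_invertible]); this locates the spectra of L
and of Phi(A). *)

(** * Uniform polynomial approximation on a segment *)

Section Weierstrass.
Context {R : realType}.
Implicit Types (g h : nat -> R) (x : R).

(** The Bernstein polynomial sum_k C(n,k) g(k) X^k (1-X)^(n-k), as the expectation
of g at a sum of n independent Bernoulli variables: conditioning on one of them
gives this recursion, which makes the moment computations below inductions
without binomial coefficients. *)
Fixpoint bernstein n g : {poly R} :=
  if n is n'.+1
  then 'X * bernstein n' (fun k => g k.+1) + (1 - 'X) * bernstein n' g
  else (g 0%N)%:P.

Lemma bernsteinS n g x :
  (bernstein n.+1 g).[x] = x * (bernstein n (fun k => g k.+1)).[x] + (1 - x) * (bernstein n g).[x].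
Proof. by rewrite /= !hornerE. Qed.

Lemma bernstein_le n g h x : 0 <= x <= 1 ->
  (forall k, (k <= n)%N -> g k <= h k) -> (bernstein n g).[x] <= (bernstein n h).[x].
Proof.
move=> /andP[x0 x1]; elim: n g h => [|n IH] g h gh.
  by rewrite /= !hornerC; apply: gh.
rewrite !bernsteinS lerD// ler_wpM2l ?subr_ge0//; apply: IH => k kn; apply: gh => //.
exact: leqW.
Qed.

(** The second moment of a binomial variable about c is its variance n x (1 - x)
plus the square of the bias n x - c. *)
Lemma bernstein_sqr n a b c x :
  (bernstein n (fun k => a + b * (k%:R - c) ^+ 2)).[x] =
  a + b * (n%:R * x * (1 - x) + (n%:R * x - c) ^+ 2).
Proof.
elim: n c => [|n IH] c; first by rewrite /= hornerC; ring.
rewrite bernsteinS IH.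
have -> : (fun k => a + b * (k.+1%:R - c) ^+ 2) =
          (fun k : nat => a + b * (k%:R - (c - 1)) ^+ 2).
  by apply/funext => k; rewrite -natr1; congr (_ + _ * _ ^+ 2); ring.
by rewrite IH -natr1; ring.
Qed.

(** Compactness, used as near-covering: around each point the required d exists
locally, hence one d serves the whole segment. *)
Lemma uniform_continuity_segment (f : R -> R) (a b : R) (e : R) : 0 < e ->
  {within `[a, b], continuous f} ->
  exists2 d, 0 < d & forall x y, x \in `[a, b] -> y \in `[a, b] ->
     `|x - y| < d -> `|f x - f y| < e.
Proof.
move=> e0 cf; pose K := [set` `[a, b]] : set R.
have cK : compact K by exact: segment_compact.
have /(compact_near_coveringP K).1 := cK.
move=> /(_ R (0^'+) (fun d x => K x -> forall y, K y ->
  `|x - y| < d -> `|f x - f y| < e) _).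
case.
  move=> x Kx.
  have e2 : 0 < e / 2 by rewrite divr_gt0.
  have /subspace_continuousP/(_ x Kx)/cvgrPdist_lt/(_ _ e2) := cf.
  rewrite /prop_near1 /within/= => /nbhs_ballP[/= r r0 rb].
  have r2 : 0 < r / 2 by rewrite divr_gt0.
  exists (ball x (r / 2), [set d | d < r/2]); first split => /=.
  - exact: nbhsx_ballx.
  - exact: nbhs_right_lt.
  move=> [z d] /= [xz dr] Kz y Ky zy.
  have fz : `|f x - f z| < e / 2.
    apply: rb => //; apply: le_ball xz.
    by rewrite ler_pdivrMr// ler_peMr// ?ler1n// ltW.
  have fy : `|f x - f y| < e / 2.
    apply: rb => //; rewrite /ball/=.
    rewrite (le_lt_trans (ler_distD z _ _))// (splitr r) ltrD//.
    exact: lt_trans zy dr.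
  rewrite (le_lt_trans (ler_distD (f x) _ _))// (splitr e) ltrD//.
  by rewrite distrC.
move=> r /= r0 rK.
exists (r / 2); first by rewrite divr_gt0.
move=> x y Kx Ky xy; apply: (rK (r/2)) => //=.
- by rewrite sub0r normrN gtr0_norm ?divr_gt0// ltr_pdivrMr// ltr_pMr// ltr1n.
- by rewrite divr_gt0.
Qed.


(** The form of uniform continuity that can be averaged against a variance: close
points are handled by e, distant ones by the total oscillation of f divided by
the square of the modulus of uniform continuity. *)
Lemma quadratic_modulus (f : R -> R) (a b e : R) : a <= b -> 0 < e ->
  {within `[a, b], continuous f} ->
  exists C, forall x y, x \in `[a, b] -> y \in `[a, b] ->
     `|f x - f y| <= e + C * (x - y) ^+ 2.
Proof.
move=> ab e0 cf; have [d d0 fd] := uniform_continuity_segment e0 cf.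
have [p pab pmax] := EVT_max ab cf; have [q qab qmin] := EVT_min ab cf.
exists ((f p - f q) / d ^+ 2) => x y xab yab.
have fpq : 0 <= f p - f q by rewrite subr_ge0 pmax.
have [xyd|dxy] := ltP `|x - y| d.
  rewrite (le_trans (ltW (fd _ _ xab yab xyd)))// lerDl mulr_ge0 ?sqr_ge0//.
  by rewrite divr_ge0// sqr_ge0.
rewrite (@le_trans _ _ (f p - f q))//.
  rewrite ler_norml.
  by move: (pmax _ xab) (pmax _ yab) (qmin _ xab) (qmin _ yab); lra.
rewrite -[leLHS]add0r lerD ?(ltW e0)//.
rewrite mulrAC ler_pdivlMr ?exprn_gt0// ler_wpM2l//.
by rewrite -(real_normK (num_real (x - y))) lerXn2r// nnegrE ltW.
Qed.

(** Rescale to [0, 1].  By [quadratic_modulus], f at the random point k/n differs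
from f(s) by at most e/2 + C (k/n - s)^2, and the average of the square is at
most 1/n. *)
Theorem weierstrass (f : R -> R) (a b e : R) : a < b -> 0 < e ->
  {within `[a, b], continuous f} ->
  exists p : {poly R}, forall s, s \in `[a, b] -> `|p.[s] - f s| <= e.
Proof.
move=> ab e0 cf.
have e2 : 0 < e / 2 by rewrite divr_gt0.
have [C fC] := quadratic_modulus (ltW ab) e2 cf.
have ba : 0 < b - a by rewrite subr_gt0.
set B := `|C| * (b - a) ^+ 2.
have B0 : 0 <= B by rewrite mulr_ge0// sqr_ge0.
have [n nB] : exists n, B / (e / 2) < n.+1%:R.
  by exists (Num.truncn (B / (e / 2))); rewrite truncnS_gt.
set N : R := n.+1%:R in nB; have N0 : 0 < N by rewrite ltr0n.
pose pt (k : nat) := a + (b - a) * (k%:R / N).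
exists (bernstein n.+1 (fun k => f (pt k)) \Po ((b - a)^-1%:P * ('X - a%:P))) => s sab.
rewrite horner_comp hornerCM hornerXsubC; set u := (b - a)^-1 * (s - a).
(* u is the position of s once [a, b] is rescaled to [0, 1]. *)
have sE : s = a + (b - a) * u by rewrite /u mulrA divff ?gt_eqF// mul1r addrC subrK.
have u01 : 0 <= u <= 1.
  move: sab; rewrite in_itv/= => /andP[as_ sb].
  rewrite /u mulr_ge0 ?subr_ge0 ?invr_ge0 ?(ltW ba)//=.
  by rewrite mulrC ler_pdivrMr// mul1r lerB.
have fpt (k : nat) : (k <= n.+1)%N ->
    `|f (pt k) - f s| <= e / 2 + B / N ^+ 2 * (k%:R - N * u) ^+ 2.
  move=> kn; have ptab : pt k \in `[a, b].
    rewrite in_itv/= /pt lerDl mulr_ge0 ?(ltW ba) ?divr_ge0//= ?(ltW N0)//.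
    by rewrite addrC -lerBrDr ler_piMr ?(ltW ba)// ler_pdivrMr// mul1r ler_nat.
  rewrite (le_trans (fC _ _ ptab sab))// lerD2l.
  have -> : B / N ^+ 2 * (k%:R - N * u) ^+ 2 = `|C| * (pt k - s) ^+ 2.
    by rewrite /B sE /pt; field; rewrite gt_eqF.
  by rewrite ler_wpM2r ?sqr_ge0// ler_norm.
have var : B / N ^+ 2 * (N * u * (1 - u) + (N * u - N * u) ^+ 2) <= e / 2.
  move: u01 => /andP[u0 u1].
  rewrite subrr expr0n addr0 (@le_trans _ _ (B / N ^+ 2 * N))//.
    rewrite ler_wpM2l ?divr_ge0 ?sqr_ge0// -mulrA ler_piMr ?(ltW N0)//.
    by rewrite mulr_ile1// ?subr_ge0// lerBlDr lerDl.
  have -> : B / N ^+ 2 * N = B / N by field; rewrite gt_eqF.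
  rewrite ler_pdivrMr// mulrC.
  by rewrite -ler_pdivrMr// ltW.
rewrite ler_distl; apply/andP; split.
- apply: (le_trans _ (bernstein_le (g := fun k => (f s - e / 2) +
      (- (B / N ^+ 2)) * (k%:R - N * u) ^+ 2) u01 _)) => [|k kn]; last first.
    by have := fpt _ kn; rewrite ler_distl mulNr opprD addrA => /andP[].
  by rewrite bernstein_sqr -/N mulNr; move: var; move: (_ * (_ + _)) => V; lra.
- apply: (le_trans (bernstein_le (h := fun k => (f s + e / 2) +
      (B / N ^+ 2) * (k%:R - N * u) ^+ 2) u01 _)) => [k kn|].
    by have := fpt _ kn; rewrite ler_distl addrA => /andP[].
  by rewrite bernstein_sqr -/N; move: var; move: (_ * (_ + _)) => V; lra.
Qed.

End Weierstrass.

(** * The real inner product underlying a complex one *)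

Lemma conj_conjc (R : rcfType) (z : R[i]) : (z^* = z^*%C)%R.
Proof.
have [->|z0] := eqVneq z 0; first by rewrite rmorph0 conjc0.
by apply: (mulfI z0); rewrite -normCK sqr_normc.
Qed.

Lemma ReD (R : rcfType) (z w : R[i]) :
  complex.Re (z + w) = complex.Re z + complex.Re w.
Proof. by case: z; case: w. Qed.

Lemma ReN (R : rcfType) (z : R[i]) : complex.Re (- z) = - complex.Re z.
Proof. by case: z. Qed.

Section RealInner.
Context {R : realType} {H : hilbertType R}.
Implicit Types (x y z : H) (A B : bop H) (r : R).

(** The real part of the inner product makes H a real Hilbert space.  The norm,
symmetry and positivity can all be read from it, so that the estimates below
are between real numbers. *)
Definition rip x y : R := complex.Re (inner x y).

Lemma innerC x y : inner y x = ((inner x y)^*)%C.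
Proof. rewrite hermC /= expr0 mul1r; exact: conj_conjc. Qed.

Lemma ripC x y : rip x y = rip y x.
Proof. by rewrite /rip (innerC y x); case: (inner y x). Qed.

Lemma ripDl x y z : rip (x + y) z = rip x z + rip y z.
Proof. rewrite /rip linearDl; exact: ReD. Qed.
Lemma ripDr x y z : rip z (x + y) = rip z x + rip z y.
Proof. by rewrite !(ripC z) ripDl. Qed.
Lemma ripZl r x y : rip (r%:C *: x) y = r * rip x y.
Proof.
rewrite /rip linearZl_LR/=; case: (inner x y) => a b /=.
by rewrite mul0r subr0.
Qed.
Lemma ripZr r x y : rip x (r%:C *: y) = r * rip x y.
Proof. by rewrite ripC ripZl ripC. Qed.
Lemma ripNl x y : rip (- x) y = - rip x y.
Proof. by rewrite /rip linearNl; exact: ReN. Qed.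
Lemma ripNr x y : rip x (- y) = - rip x y.
Proof. by rewrite ripC ripNl ripC. Qed.
Lemma ripBl x y z : rip (x - y) z = rip x z - rip y z.
Proof. by rewrite ripDl ripNl. Qed.
Lemma ripBr x y z : rip z (x - y) = rip z x - rip z y.
Proof. by rewrite ripDr ripNr. Qed.
Lemma rip0l x : rip 0 x = 0.
Proof. by rewrite /rip linear0l. Qed.
Lemma rip0r x : rip x 0 = 0.
Proof. by rewrite ripC rip0l. Qed.

Lemma ripii x y : rip ('i *: x) ('i *: y) = rip x y.
Proof.
rewrite /rip linearZl_LR linearZr_LR/=; case: (inner x y) => a b /=.
by ring.
Qed.

(** The imaginary part is the real part tested against a rotated vector: this is
how complex statements are recovered from real ones. *)
Lemma inner_rip x y : inner x y = rip x y +i* rip x ('i *: y).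
Proof.
rewrite /rip linearZr_LR/=; case: (inner x y) => a b /=.
by congr Complex; ring.
Qed.

Lemma normE x : `|x| ^+ 2 = (rip x x)%:C.
Proof.
by rewrite inner_norm /rip RRe_real// realE -inner_norm exprn_ge0.
Qed.

Lemma rip_ge0 x : 0 <= rip x x.
Proof. by rewrite -lecR -normE exprn_ge0. Qed.

Lemma rip_eq0 x : rip x x = 0 -> x = 0.
Proof.
by move=> x0; apply/eqP; rewrite -normr_eq0 -sqrf_eq0 normE x0.
Qed.

Lemma norm_sqrt x : `|x| = (Num.sqrt (rip x x))%:C.
Proof.
apply/eqP; rewrite -(@eqrXn2 _ 2)//; last by rewrite lecR sqrtr_ge0.
by rewrite normE -rmorphXn/= sqr_sqrtr ?rip_ge0.
Qed.

Lemma le_norm c x y : 0 <= c ->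
  (`|x| <= c%:C * `|y|) = (rip x x <= c ^+ 2 * rip y y).
Proof.
move=> c0; rewrite -(@ler_pXn2r _ 2) ?nnegrE// ?mulr_ge0// ?lecR//.
by rewrite exprMn !normE -rmorphXn -rmorphM lecR.
Qed.

End RealInner.

(** * Limits in Hilbert space and positive operators *)

Section HilbertLimits.
Context {R : realType} {H : hilbertType R}.
Implicit Types (x y z : H) (r : R).

Lemma rip_Cauchy_Schwarz x y : rip x y ^+ 2 <= rip x x * rip y y.
Proof.
have [y0|y0] := eqVneq (rip y y) 0.
  by rewrite (rip_eq0 y0) !rip0r mulr0 expr0n.
have yy : 0 < rip y y by rewrite lt_def y0 rip_ge0.
have := rip_ge0 (x - (rip x y / rip y y)%:C *: y).
rewrite ripBl !ripBr !ripZl !ripZr (ripC y x).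
rewrite divfK// subrr subr0 subr_ge0 mulrAC ler_pdivrMr//.
Qed.

Lemma ripil x y : rip ('i *: x) y = - rip x ('i *: y).
Proof. by rewrite -ripii scalerA -expr2 sqr_i scaleN1r ripNl. Qed.

Lemma rip_ext x y : (forall z, rip x z = rip y z) -> x = y.
Proof.
by move=> xy; apply/subr0_eq/rip_eq0; rewrite ripBl xy subrr.
Qed.

Lemma cvg_rip_dist (u : nat -> H) l : u @ \oo --> l ->
  rip (u n - l) (u n - l) @[n --> \oo] --> (0 : R).
Proof.
move=> /cvgrPdist_lt ul; apply/cvgrPdist_lt => e e0.
have : 0 < (Num.sqrt e)%:C :> R[i] by rewrite ltcR sqrtr_gt0.
move=> /ul; apply: filterS => n; rewrite distrC => un.
rewrite sub0r normrN ger0_norm ?rip_ge0// -ltcR -normE.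
by rewrite -(sqr_sqrtr (ltW e0)) rmorphXn ltr_pXn2r// nnegrE// lecR sqrtr_ge0.
Qed.

Lemma cvg_rip (u : nat -> H) l y : u @ \oo --> l ->
  rip (u n) y @[n --> \oo] --> rip l y.
Proof.
move=> /cvg_rip_dist/cvgrPdist_lt ul; apply/cvgrPdist_lt => e e0.
have y1 : 0 < rip y y + 1 by rewrite ltr_wpDl ?rip_ge0.
have : 0 < e ^+ 2 / (rip y y + 1) by rewrite divr_gt0 ?exprn_gt0.
move=> /ul; apply: filterS => n; rewrite sub0r normrN ger0_norm ?rip_ge0//.
rewrite ltr_pdivlMr// => un.
rewrite distrC -ripBl -(ltr_pXn2r (_ : 0 < 2)%N) ?nnegrE ?(ltW e0)//.
rewrite real_normK ?num_real// (le_lt_trans (rip_Cauchy_Schwarz _ _))//.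
by rewrite (le_lt_trans _ un)// ler_wpM2l ?rip_ge0// lerDl.
Qed.

(** From 2 <u_n, l> <= |u_n|^2 + |l|^2: weak convergence already bounds the
norm of the limit. *)
Lemma cvg_rip_le (u : nat -> H) l c : u @ \oo --> l ->
  (\forall n \near \oo, rip (u n) (u n) <= c) -> rip l l <= c.
Proof.
move=> ul uc.
suff : rip l l <= (c + rip l l) / 2 by lra.
apply: cvgr_to_le (@cvg_rip _ _ l ul) _.
move: uc; apply: filterS => n un.
have := rip_ge0 (u n - l); rewrite ripBl !ripBr (ripC l); lra.
Qed.

Lemma hilbert_cauchy (u : nat -> H) :
  (forall e : R, 0 < e -> exists N, forall n m, (N <= n)%N -> (N <= m)%N ->
     rip (u n - u m) (u n - u m) <= e) ->
  exists l : H, u @ \oo --> l.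
Proof.
move=> uc; apply/cvg_ex/cauchy_cvgP; apply/cauchy_ballP => e e0; near_simpl.
have eE : e = (complex.Re e)%:C by rewrite RRe_real// gtr0_real.
have re0 : 0 < complex.Re e by rewrite -ltcR -eE.
have [N uN] := uc ((complex.Re e / 2) ^+ 2) (exprn_gt0 _ (divr_gt0 re0 (ltr0n _ 2))).
exists ([set n | N <= n]%N, [set n | N <= n]%N); first by split; exists N.
move=> [n m] /= [Nn Nm]; rewrite -ball_normE /= norm_sqrt eE ltcR.
rewrite (@le_lt_trans _ _ (complex.Re e / 2))//; last by lra.
rewrite -(ler_pXn2r (_ : 0 < 2)%N) ?nnegrE ?sqrtr_ge0//; last by lra.
by rewrite sqr_sqrtr ?rip_ge0// uN.
Qed.

End HilbertLimits.

Section Operators.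
Context {R : realType} {H : hilbertType R}.
Implicit Types (A B S T : bop H) (x y : H) (z : R[i]) (r : R).

Lemma bopD A B x : (A + B) x = A x + B x. Proof. by []. Qed.
Lemma bopN A x : (- A) x = - A x. Proof. by []. Qed.
Lemma bopZ z A x : (z *: A) x = z *: A x. Proof. by []. Qed.
Lemma bopM A B x : (A * B) x = A (B x). Proof. by []. Qed.
Lemma bop1E x : (1 : bop H) x = x. Proof. by []. Qed.
Definition bopE := (bopD, bopN, bopZ, bopM, bop1E).

Lemma bopxD A x y : A (x + y) = A x + A y. Proof. exact: linearD. Qed.
Lemma bopxB A x y : A (x - y) = A x - A y. Proof. exact: linearB. Qed.
Lemma bopxZ A z x : A (z *: x) = z *: A x. Proof. exact: linearZ. Qed.

Lemma scale_bopAl z A B : z *: (A * B) = (z *: A) * B.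
Proof. exact: bopP. Qed.
Lemma scale_bopAr z A B : z *: (A * B) = A * (z *: B).
Proof. by apply: bopP => x; rewrite !bopE linearZ. Qed.

Definition symmetric_op A := forall x y, rip (A x) y = rip x (A y).

Lemma self_adjointP A : self_adjoint A <-> symmetric_op A.
Proof.
split=> sA x y; first by rewrite /rip sA.
by rewrite !inner_rip !sA linearZ.
Qed.

(** Over the complex numbers a positive operator is automatically symmetric, by
polarization with x + i y. *)
Lemma op_posP A : op_pos A <-> symmetric_op A /\ forall x, 0 <= rip (A x) x.
Proof.
split=> [pA|[sA pA] x]; last first.
  rewrite inner_rip lecE /= pA andbT.
  suff : rip (A x) ('i *: x) = 0 by move=> ->.
  have := sA x ('i *: x); rewrite linearZ/= (ripC x) ripil; lra.
have iA x : rip (A x) ('i *: x) = 0.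
  by have := pA x; rewrite inner_rip lecE/= => /andP[/eqP].
have rA x : 0 <= rip (A x) x.
  by have := pA x; rewrite inner_rip lecE/= => /andP[].
split=> // x y.
have := iA (x + 'i *: y).
rewrite linearD linearZ/= scalerDr scalerA -expr2 sqr_i scaleN1r.
rewrite !(ripDl, ripDr) !ripNr iA ripii (ripil _ y) iA (ripC x); lra.
Qed.

End Operators.

(** * Inverting coercive operators *)

Section Coercive.
Context {R : realType} {H : hilbertType R}.
Implicit Types (A B S T : bop H) (x y : H) (z : R[i]) (r : R).

Lemma bop_bound A (d : R) : exists2 c, d < c & 0 < c /\
  forall x, rip (A x) (A x) <= c ^+ 2 * rip x x.
Proof.
have [c c0 cA] := bounded_linear_ge0 (bop_funP A).
exists (c + `|d| + 1); first by have := ler_norm d; lra.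
have d0 := normr_ge0 d; split; first by lra.
move=> x; rewrite -le_norm; last lra.
by rewrite (le_trans (cA x))// ler_wpM2r// lecR; lra.
Qed.

Lemma bop_of_fun (f : H -> H) (c : R) : 0 <= c -> linear f ->
  (forall x, rip (f x) (f x) <= c ^+ 2 * rip x x) ->
  exists B : bop H, forall x, B x = f x.
Proof.
move=> c0 lf cf.
have bf : f \in @bounded_linear R H.
  by rewrite inE; split=> //; exists c => x; rewrite le_norm.
by exists (Bop bf).
Qed.

Definition invertible_op T := exists B : bop H, T * B = 1 /\ B * T = 1.

(** A squared triangle inequality: the two sides differ by a multiple of
|(1 - l) x - l y|^2. *)
Lemma rip_convex (l : R) x y : 0 < l < 1 ->
  rip (x + y) (x + y) <= l^-1 * rip x x + (1 - l)^-1 * rip y y.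
Proof.
move=> /andP[l0 l1]; have l1' : 0 < 1 - l by rewrite subr_gt0.
pose w := (1 - l)%:C *: x - l%:C *: y.
suff E : l^-1 * rip x x + (1 - l)^-1 * rip y y - rip (x + y) (x + y) =
    (l * (1 - l))^-1 * rip w w.
  by rewrite -subr_ge0 E mulr_ge0 ?rip_ge0// invr_ge0 ltW// mulr_gt0.
rewrite /w !(ripBl, ripBr, ripZl, ripZr, ripDl, ripDr) (ripC y x).
by field; rewrite ?gt_eqF.
Qed.

(** Expand |S x - d x|^2 >= 0. *)
Lemma coercive_lower S d x : 0 <= d -> d * rip x x <= rip (S x) x ->
  d ^+ 2 * rip x x <= rip (S x) (S x).
Proof.
move=> d0 dS; have := rip_ge0 (S x - d%:C *: x).
rewrite !(ripBl, ripBr, ripZl, ripZr) (ripC x) => h.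
have := ler_wpM2l d0 dS; rewrite mulrA -expr2; move: h; lra.
Qed.

(** For tau = d / c^2, with c a bound of S, the map x |-> x - tau (S x - y) is a
contraction, whose fixed point solves S x = y. *)
Lemma coercive_surj S d y : 0 < d -> symmetric_op S ->
  (forall x, d * rip x x <= rip (S x) x) -> exists x, S x = y.
Proof.
move=> d0 sS dS.
have [c dc [c0 cS]] := bop_bound S d.
pose tau := d / c ^+ 2; pose q := 1 - (d / c) ^+ 2.
have dc01 : 0 < d / c < 1 by rewrite divr_gt0// ltr_pdivrMr// mul1r.
have [q0 q1] : 0 < q /\ q < 1.
  by move: dc01 => /andP[? ?]; rewrite /q; split; nra.
have tau0 : 0 < tau by rewrite divr_gt0// exprn_gt0.
pose T x := x - tau%:C *: S x.
have TB x x' : T x - T x' = T (x - x').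
  by rewrite /T bopxB scalerBr !opprD addrACA.
have Tq x : rip (T x) (T x) <= q * rip x x.
  rewrite /T !(ripBl, ripBr, ripZl, ripZr) (ripC x (S x)).
  have h1 := ler_wpM2l (sqr_ge0 tau) (cS x).
  have h2 := ler_wpM2l (ltW tau0) (dS x).
  have E1 : tau ^+ 2 * (c ^+ 2 * rip x x) = (d / c) ^+ 2 * rip x x.
    by rewrite /tau; field; rewrite gt_eqF.
  have E2 : tau * (d * rip x x) = (d / c) ^+ 2 * rip x x.
    by rewrite /tau; field; rewrite gt_eqF.
  by rewrite /q; move: h1 h2; rewrite E1 E2; lra.
(* The iterates are u_n, starting from 0; l lies halfway between q and 1, and
   M0 is the fixed point of the bound r |-> (q / l) r + K / (1 - l) that
   [rip_convex] gives for the squared norms of the iterates. *)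
pose u := fix u n := if n is n'.+1 then T (u n') + tau%:C *: y else 0.
have uS n : u n.+1 = T (u n) + tau%:C *: y by [].
pose l := (1 + q) / 2.
have l01 : 0 < l < 1 by rewrite /l; apply/andP; split; lra.
have l0 : 0 < l by case/andP: l01.
pose K := rip (tau%:C *: y) (tau%:C *: y).
have K0 : 0 <= K by exact: rip_ge0.
pose M0 := K * l / ((1 - l) * (l - q)).
have ll : 0 < 1 - l /\ 0 < l - q by rewrite /l; split; lra.
case: ll => l1 lq.
have M00 : 0 <= M0 by apply: divr_ge0; apply: mulr_ge0 => //; exact: ltW.
have uM n : rip (u n) (u n) <= M0.
  elim: n => [|n IH]; first by rewrite rip0l.
  rewrite uS (le_trans (rip_convex _ _ l01))// -/K.
  have -> : M0 = l^-1 * (q * M0) + (1 - l)^-1 * K.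
    by rewrite /M0; field; rewrite ?gt_eqF.
  rewrite lerD2r ler_wpM2l ?invr_ge0 ?(ltW l0)// (le_trans (Tq _))//.
  by rewrite ler_wpM2l// ltW.
have uq n k : rip (u (n + k)%N - u n) (u (n + k)%N - u n) <= q ^+ n * M0.
  elim: n => [|n IH]; first by rewrite subr0 expr0 mul1r.
  rewrite addSn !uS opprD addrACA subrr addr0 TB (le_trans (Tq _))//.
  by rewrite exprS -mulrA ler_wpM2l// ltW.
have qM : q ^+ n * M0 @[n --> \oo] --> (0 : R).
  rewrite -[X in _ --> X](mul0r M0); apply: cvgMr_tmp.
  by apply: cvg_expr; rewrite ger0_norm// ltW.
(* The difference u_(n+k) - u_n is the linear map T iterated n times on u_k. *)
have [|x ux] := @hilbert_cauchy _ _ u.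
  move=> e e0; have /cvgrPdist_le/(_ _ e0)[N _ NE] := qM.
  exists N => n m Nn Nm; wlog nm : n m Nn Nm / (n <= m)%N.
    move=> W; have [/W->//|/ltnW/W] := leqP n m.
    by rewrite -opprB ripNl ripNr opprK; apply.
  rewrite -opprB ripNl ripNr opprK -(subnKC nm) (le_trans (uq _ _))//.
  by have := NE _ Nn; rewrite sub0r normrN; apply: le_trans; exact: ler_norm.
exists x; apply: rip_ext => z.
have e1 : rip (u n.+1) z @[n --> \oo] --> rip x z.
  by have := @cvg_rip _ _ _ _ z ux; rewrite -(cvg_shiftS (fun n => rip (u n) z)).
have e2 : rip (u n.+1) z @[n --> \oo] -->
    rip x z - tau * rip x (S z) + tau * rip y z.
  have -> : (fun n => rip (u n.+1) z) =
      (fun n => rip (u n) z - tau * rip (u n) (S z) + tau * rip y z).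
    by apply/funext => n; rewrite uS ripDl /T ripBl !ripZl sS.
  apply: cvgD; last exact: cvg_cst.
  apply: cvgB; first exact: cvg_rip.
  by apply: cvgMl_tmp; exact: cvg_rip.
have E := cvg_unique (@norm_hausdorff _ _) e1 e2; rewrite sS.
apply: (mulfI (negbT (gt_eqF tau0))); apply/subr0_eq/oppr_inj.
by rewrite oppr0 opprB addrC; apply: (addrI (rip x z)); rewrite addrA addr0 -E.
Qed.

(** Coercivity makes S injective with a bounded inverse on its range, and the range
is everything by [coercive_surj]. *)
Theorem coercive_invertible S d : 0 < d -> symmetric_op S ->
  (forall x, d * rip x x <= rip (S x) x) -> invertible_op S.
Proof.
move=> d0 sS dS.
have inj x : S x = 0 -> x = 0.
  move=> Sx; apply: rip_eq0; apply/eqP; rewrite eq_le rip_ge0 andbT.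
  by have := dS x; rewrite Sx rip0l pmulr_rle0.
have [g gE] : exists g : H -> H, forall y, S (g y) = y.
  exists (fun y => projT1 (cid (coercive_surj y d0 sS dS))) => y.
  by case: cid.
have lg : linear g.
  move=> a x y; apply/subr0_eq/inj.
  by rewrite bopxB bopxD bopxZ !gE subrr.
have [B BE] : exists B : bop H, forall x, B x = g x.
  have d1 : 0 <= d^-1 by rewrite invr_ge0 ltW.
  apply: (bop_of_fun d1 lg) => y;
  rewrite exprVn -ler_pdivrMl ?invr_gt0 ?exprn_gt0// invrK.
  by have := coercive_lower (ltW d0) (dS (g y)); rewrite gE.
exists B; split; apply: bopP => x; rewrite !bopE BE ?gE//.
by apply/subr0_eq/inj; rewrite bopxB gE subrr.
Qed.

End Coercive.

(** * Spectrum and numerical range of a symmetric operator *)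

Section Spectrum.
Context {R : realType} {H : hilbertType R}.
Implicit Types (A B S T U V : bop H) (x y : H) (z : R[i]) (r : R).

Lemma invertible_opM S T :
  invertible_op S -> invertible_op T -> invertible_op (S * T).
Proof.
move=> [S' [SS' S'S]] [T' [TT' T'T]]; exists (T' * S'); split.
- by rewrite mulrA -(mulrA S) TT' mulr1.
- by rewrite mulrA -(mulrA T') S'S mulr1.
Qed.

Lemma invertible_op_comm U V : U * V = V * U ->
  invertible_op (U * V) -> invertible_op U.
Proof.
move=> UV [B [h1 h2]]; exists (V * B); rewrite mulrA; split=> //.
have -> : V * B = B * V.
  by rewrite -[LHS]mul1r -[X in X * _]h2 UV -!mulrA (mulrA U) h1 mulr1.
by rewrite -mulrA -UV.
Qed.

Lemma invertible_opZ z T : invertible_op (z *: T) -> invertible_op T.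
Proof.
move=> [B [h1 h2]]; exists (z *: B); split.
- by rewrite -scale_bopAr scale_bopAl.
- by rewrite -scale_bopAl scale_bopAr.
Qed.

Lemma symmetric_opD A B :
  symmetric_op A -> symmetric_op B -> symmetric_op (A + B).
Proof. by move=> sA sB x y; rewrite !bopE ripDl ripDr sA sB. Qed.

Lemma symmetric_opZ r A : symmetric_op A -> symmetric_op (r%:C *: A).
Proof. by move=> sA x y; rewrite !bopE ripZl ripZr sA. Qed.

Lemma symmetric_op1 : symmetric_op (1 : bop H). Proof. by []. Qed.

Lemma symmetric_opN A : symmetric_op A -> symmetric_op (- A).
Proof. by move=> sA x y; rewrite !bopE ripNl ripNr sA. Qed.

Lemma symmetric_shift r A : symmetric_op A -> symmetric_op (A - r%:C *: (1 : bop H)).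
Proof.
move=> sA; apply/symmetric_opD/symmetric_opN/symmetric_opZ => //.
Qed.

Lemma rip_shift r A x y :
  rip ((A - r%:C *: (1 : bop H)) x) y = rip (A x) y - r * rip x y.
Proof. by rewrite !bopE ripBl ripZl. Qed.

(** Expand |S x - c x|^2 >= 0. *)
Lemma bop_upper S c x : 0 < c -> rip (S x) (S x) <= c ^+ 2 * rip x x ->
  rip (S x) x <= c * rip x x.
Proof.
move=> c0 h; have := rip_ge0 (S x - c%:C *: x).
rewrite !(ripBl, ripBr, ripZl, ripZr) (ripC x) => h2.
by rewrite -(ler_pM2l c0) mulrA -expr2; lra.
Qed.

Lemma bop_lower S c x : 0 < c -> rip (S x) (S x) <= c ^+ 2 * rip x x ->
  - c * rip x x <= rip (S x) x.
Proof.
move=> c0 h; have := @bop_upper (- S) c x c0.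
by rewrite !bopE !ripNl ripNr opprK => /(_ h); lra.
Qed.

(** The converse of [coercive_invertible] for positive operators.  If c bounds S,
positivity of S at x - S x / c gives |S x|^2 <= c <S x, x>; if k bounds the
inverse of S, then |x|^2 <= k^2 |S x|^2. *)
Lemma pos_invertible_coercive S : symmetric_op S -> (forall x, 0 <= rip (S x) x) ->
  invertible_op S -> exists2 e, 0 < e & forall x, e * rip x x <= rip (S x) x.
Proof.
move=> sS pS [B [_ BS]].
have [c _ [c0 cS]] := bop_bound S 0.
have [k _ [k0 kB]] := bop_bound B 0.
have SS x : rip (S x) (S x) <= c * rip (S x) x.
  have := pS (x - c^-1%:C *: S x).
  rewrite bopxB bopxZ !(ripBl, ripBr, ripZl, ripZr) (sS (S x) x) => h1.
  have h2 := bop_upper c0 (cS (S x)).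
  have h3 : c^-1 * (c^-1 * rip (S (S x)) (S x)) <= c^-1 * rip (S x) (S x).
    by rewrite ler_pM2l ?invr_gt0// ler_pdivrMl.
  rewrite -ler_pdivrMl//; move: h1 h3; lra.
exists (k ^+ 2 * c)^-1; first by rewrite invr_gt0 mulr_gt0// exprn_gt0.
move=> x; rewrite ler_pdivrMl ?mulr_gt0// ?exprn_gt0//.
have := kB (S x); have -> : B (S x) = x by rewrite -bopM BS.
move=> h; rewrite (le_trans h)// -[leRHS]mulrA ler_wpM2l// ?sqr_ge0//.
Qed.

(** The number l is the supremum of those for which T >= l.  It is in the spectrum:
otherwise T - l, being positive and invertible, would be coercive and l could be
increased.  In particular the spectrum is not empty when H is not null. *)
Lemma spectrum_lower_bound T x0 : symmetric_op T -> x0 != 0 ->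
  exists2 l, spectrum T l%:C & forall x, l * rip x x <= rip (T x) x.
Proof.
move=> sT x00.
have x0p : 0 < rip x0 x0.
  by rewrite lt_def rip_ge0 andbT; apply: contraNneq x00 => /rip_eq0 ->.
pose E := [set l | forall x, l * rip x x <= rip (T x) x].
have ubE : ubound E (rip (T x0) x0 / rip x0 x0).
  by move=> l El; rewrite ler_pdivlMr//; exact: El.
have hsE : has_sup E.
  split; last by exists (rip (T x0) x0 / rip x0 x0).
  have [c _ [c0 cT]] := bop_bound T 0.
  by exists (- c) => x; exact: bop_lower.
have Es : E (sup E).
  move=> x; have [x0'|xn0] := eqVneq (rip x x) 0.
    by rewrite (rip_eq0 x0') rip0r mulr0 rip0r.
  have xp : 0 < rip x x by rewrite lt_def xn0 rip_ge0.
  rewrite -ler_pdivlMr//; apply: ge_sup => [|l El]; first by case: hsE.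
  by rewrite ler_pdivlMr//; exact: El.
exists (sup E) => // invT.
have [] := @pos_invertible_coercive (T - (sup E)%:C *: (1 : bop H)) _ _ invT.
- exact: symmetric_shift.
- by move=> x; rewrite rip_shift subr_ge0; exact: Es.
move=> e e0 eT; have : E (sup E + e).
  by move=> x; have := eT x; rewrite rip_shift; lra.
move=> /(sup_upper_bound hsE); lra.
Qed.

(** When w = +/- i b, the product (S - w)(S + w) is S^2 + b^2, which is coercive. *)
Lemma imaginary_invertible S b w : symmetric_op S -> b != 0 ->
  w * w = - (b ^+ 2)%:C -> invertible_op (S - w *: (1 : bop H)).
Proof.
move=> sS b0 ww.
have UV : (S - w *: (1 : bop H)) * (S + w *: (1 : bop H)) =
    S * S + (b ^+ 2)%:C *: (1 : bop H).
  apply: bopP => x; rewrite !bopE bopxD bopxZ scalerDr scalerA ww scaleNr.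
  by rewrite opprD opprK addrA; congr (_ + _); rewrite -addrA subrr addr0.
have VU : (S + w *: (1 : bop H)) * (S - w *: (1 : bop H)) =
    S * S + (b ^+ 2)%:C *: (1 : bop H).
  apply: bopP => x; rewrite !bopE bopxB bopxZ scalerBr scalerA ww scaleNr.
  by rewrite opprK addrA; congr (_ + _); rewrite -addrA addNr addr0.
apply: (@invertible_op_comm _ (S + w *: (1 : bop H))); first by rewrite UV VU.
rewrite UV; apply: (@coercive_invertible _ _ _ (b ^+ 2)).
- by rewrite exprn_even_gt0//= b0.
- by move=> x y; rewrite !bopE ripDl ripDr !sS ripZl ripZr.
- by move=> x; rewrite !bopE ripDl ripZl sS lerDr rip_ge0.
Qed.

Lemma nonreal_invertible T a b : symmetric_op T -> b != 0 ->
  invertible_op (T - (a +i* b) *: (1 : bop H)).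
Proof.
move=> sT b0.
have -> : T - (a +i* b) *: (1 : bop H) =
    (T - a%:C *: (1 : bop H)) - (0 +i* b) *: (1 : bop H).
  by rewrite -addrA -opprD -scalerDl; congr (_ - _ *: _); simpc.
apply: imaginary_invertible b0 _; first exact: symmetric_shift.
by simpc; rewrite expr2.
Qed.

(** A real number outside [m, M] makes T - a or a - T coercive. *)
Lemma spectrum_bounds T m M : symmetric_op T ->
  (forall x, m * rip x x <= rip (T x) x <= M * rip x x) ->
  spectrum T `<=` [set s%:C | s in `[m, M]].
Proof.
move=> sT mTM [a b]; rewrite /spectrum/= => ninv.
have b0 : b = 0.
  by apply/eqP; apply: contrapT => /negP b0; apply: ninv; exact: nonreal_invertible.
exists a; last by rewrite b0.
rewrite b0 in ninv; rewrite /= in_itv/=; apply/andP.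
split; rewrite leNgt; apply/negP => h; apply: ninv.
- apply: (@coercive_invertible _ _ _ (m - a)); first by rewrite subr_gt0.
    exact: symmetric_shift.
  by move=> x; rewrite rip_shift mulrBl lerB//; have /andP[] := mTM x.
- apply: (@invertible_opZ (-1)).
  apply: (@coercive_invertible _ _ _ (a - M)); first by rewrite subr_gt0.
    have -> : (-1 : R[i]) = (-1)%:C by rewrite rmorphN1.
    by apply: symmetric_opZ; exact: symmetric_shift.
  move=> x; rewrite bopZ scaleN1r ripNl rip_shift mulrBl opprB lerB//.
  by have /andP[] := mTM x.
Qed.

Lemma spectrum_ge T m : symmetric_op T ->
  (forall s, spectrum T s%:C -> m <= s) -> forall x, m * rip x x <= rip (T x) x.
Proof.
move=> sT mT x; have [->|x0] := eqVneq x 0; first by rewrite !rip0r mulr0.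
have [l lT lx] := spectrum_lower_bound sT x0.
by rewrite (le_trans _ (lx x))// ler_wpM2r ?rip_ge0// mT.
Qed.

End Spectrum.

(** * Polynomials in a symmetric operator *)

Section PolynomialCalculus.
Context {R : realType} {H : hilbertType R}.
Implicit Types (A B S T : bop H) (x y : H) (z : R[i]) (r : R).

(** The counterpart of [op_horner] for complex coefficients, needed to split a real
polynomial into linear factors. *)
Definition cop_horner (p : {poly R[i]}) A : bop H :=
  \sum_(i < size p) p`_i *: (A ^+ i : bop H).

Lemma cop_horner_wide n (p : {poly R[i]}) A : (size p <= n)%N ->
  cop_horner p A = \sum_(i < n) p`_i *: (A ^+ i : bop H).
Proof.
move=> pn; rewrite /cop_horner.
rewrite (big_ord_widen n (fun i => p`_i *: (A ^+ i : bop H)))//.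
rewrite [in LHS]big_mkcond; apply: eq_bigr => i _; case: ltnP => // pi.
by rewrite nth_default// scale0r.
Qed.

Lemma cop_hornerD (p q : {poly R[i]}) A :
  cop_horner (p + q) A = cop_horner p A + cop_horner q A.
Proof.
set n := maxn (size p) (size q).
rewrite !(@cop_horner_wide n) ?leq_maxl ?leq_maxr ?size_polyD// -big_split/=.
by apply: eq_bigr => i _; rewrite coefD scalerDl.
Qed.

Lemma cop_hornerZ z (p : {poly R[i]}) A :
  cop_horner (z *: p) A = z *: cop_horner p A.
Proof.
rewrite !(@cop_horner_wide (size p)) ?size_scale_leq// scaler_sumr.
by apply: eq_bigr => i _; rewrite coefZ scalerA.
Qed.

Lemma cop_hornerC z A : cop_horner z%:P A = z *: (1 : bop H).
Proof.
by rewrite (@cop_horner_wide 1) ?size_polyC_leq1// big_ord1 coefC/= expr0.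
Qed.

Lemma cop_hornerMX (p : {poly R[i]}) A :
  cop_horner (p * 'X) A = cop_horner p A * A.
Proof.
rewrite (@cop_horner_wide (size p).+1); last first.
  by have := size_polyMleq p 'X; rewrite size_polyX addn2.
rewrite big_ord_recl coefMX/= scale0r add0r /cop_horner mulr_suml.
apply: eq_bigr => i _; rewrite coefMX/= /bump/= add1n exprSr.
by rewrite scale_bopAl.
Qed.

Lemma cop_hornerMXaddC (p : {poly R[i]}) z A :
  cop_horner (p * 'X + z%:P) A = cop_horner p A * A + z *: (1 : bop H).
Proof. by rewrite cop_hornerD cop_hornerMX cop_hornerC. Qed.

Lemma cop_hornerM (p q : {poly R[i]}) A :
  cop_horner (p * q) A = cop_horner p A * cop_horner q A.
Proof.
elim/poly_ind: q => [|q z IH].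
  by rewrite mulr0 /cop_horner size_poly0 !big_ord0 mulr0.
rewrite mulrDr mulrA cop_hornerD cop_hornerMX IH cop_hornerMXaddC mulrDr mulrA.
congr (_ + _); rewrite mulrC mul_polyC cop_hornerZ -scale_bopAr mulr1//.
Qed.

Lemma cop_hornerX A : cop_horner 'X A = A.
Proof.
by rewrite -[X in cop_horner X]mul1r cop_hornerMX cop_hornerC scale1r mul1r.
Qed.

(** Factor p over the complex numbers: a product of invertible operators is
invertible, so some factor A - z is not.  The point z0 only serves when p is
the null polynomial, which has no factorization. *)
Lemma cop_horner_root (p : {poly R[i]}) A z0 :
  spectrum A z0 ->
  ~ invertible_op (cop_horner p A) ->
  exists2 z, spectrum A z & root p z.
Proof.
move=> Az0; have [n] := ubnP (size p); elim: n p => // n IH p.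
rewrite ltnS => pn ninv.
have [p0|p0] := eqVneq p 0; first by exists z0 => //; rewrite p0 root0.
have [p1|p1] := eqVneq (size p) 1%N.
  exfalso; apply: ninv; have [c c0 ->] := size_poly1P _ (introT eqP p1).
  exists (c^-1 *: (1 : bop H)); rewrite cop_hornerC.
  by split; rewrite -scale_bopAl mul1r scalerA ?divff ?mulVf// scale1r.
have [z pz] := closed_rootP _ p1.
have [Az|/contrapT invz] := pselect (spectrum A z); first by exists z.
have [q pE] := factor_theorem _ _ pz.
have [||w Aw qw] := IH q.
- rewrite (leq_trans _ pn)// pE size_Mmonic ?monicXsubC ?size_XsubC ?addn2//.
  by apply: contraNneq p0 => q0; rewrite pE q0 mul0r.
- move=> invq; apply: ninv; rewrite pE cop_hornerM; apply: invertible_opM => //.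
  by rewrite -polyCN cop_hornerD cop_hornerX cop_hornerC scaleNr.
- by exists w => //; rewrite pE rootM qw.
Qed.

Lemma op_hornerE (p : {poly R}) A :
  op_horner p A = cop_horner (map_poly (real_complex R) p) A.
Proof.
rewrite /op_horner /cop_horner size_map_poly.
by apply: eq_bigr => i _; rewrite coef_map.
Qed.

Lemma op_hornerD (p q : {poly R}) A :
  op_horner (p + q) A = op_horner p A + op_horner q A.
Proof. by rewrite !op_hornerE rmorphD cop_hornerD. Qed.

Lemma op_hornerM (p q : {poly R}) A :
  op_horner (p * q) A = op_horner p A * op_horner q A.
Proof. by rewrite !op_hornerE rmorphM cop_hornerM. Qed.

Lemma op_hornerC r A : op_horner r%:P A = r%:C *: (1 : bop H).
Proof. by rewrite !op_hornerE map_polyC cop_hornerC. Qed.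

Lemma op_hornerX A : op_horner 'X A = A.
Proof. by rewrite !op_hornerE map_polyX cop_hornerX. Qed.

Lemma op_hornerN (p : {poly R}) A :
  op_horner (- p) A = - op_horner p A.
Proof.
by apply/eqP; rewrite -addr_eq0 -op_hornerD addNr -[0]/(0%:P) op_hornerC scale0r.
Qed.

Lemma op_hornerB (p q : {poly R}) A :
  op_horner (p - q) A = op_horner p A - op_horner q A.
Proof. by rewrite op_hornerD op_hornerN. Qed.

Lemma op_horner_comp (p q : {poly R}) A :
  op_horner (p \Po q) A = op_horner p (op_horner q A).
Proof.
elim/poly_ind: p => [|p c IH]; first by rewrite comp_poly0 -[0]/(0%:P) !op_hornerC.
by rewrite comp_poly_MXaddC !op_hornerD !op_hornerM IH op_hornerX !op_hornerC.
Qed.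

Lemma symmetric_op_horner (p : {poly R}) A :
  symmetric_op A -> symmetric_op (op_horner p A).
Proof.
move=> sA; elim/poly_ind: p => [|p c IH].
  by rewrite -[0]/(0%:P) op_hornerC; apply: symmetric_opZ; exact: symmetric_op1.
rewrite op_hornerD op_hornerC; apply: symmetric_opD; last first.
  by apply: symmetric_opZ; exact: symmetric_op1.
move=> x y; rewrite op_hornerM op_hornerX.
have C : op_horner p A * A = A * op_horner p A.
  by rewrite -{2 3}(op_hornerX A) -!op_hornerM mulrC.
by rewrite {1}C bopM sA IH.
Qed.

Definition real_spectrum A := forall z, spectrum A z -> exists s, z = s%:C.

(** Any lower bound of p on the spectrum of A is one for the spectrum of p(A), hence
for its numerical range by [spectrum_ge]. *)
Lemma op_horner_ge0 (p : {poly R}) A :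
  symmetric_op A -> real_spectrum A ->
  (forall s, spectrum A s%:C -> 0 <= p.[s]) ->
  forall x, 0 <= rip (op_horner p A x) x.
Proof.
move=> sA rA p0 x; have [->|x0] := eqVneq x 0; first by rewrite rip0r.
have [l0 l0A _] := spectrum_lower_bound sA x0.
rewrite -[leLHS](mul0r (rip x x)).
apply: spectrum_ge; first exact: symmetric_op_horner.
move=> l; rewrite -[spectrum _ _]/(~ invertible_op (_ - l%:C *: (1 : bop H))).
rewrite -(op_hornerC l A) -op_hornerB op_hornerE => /(cop_horner_root l0A)[z Az].
have [s zs] := rA _ Az; rewrite zs in Az *.
rewrite /root horner_map/= hornerD hornerN hornerC.
rewrite -(rmorph0 (real_complex R)) => /eqP/complexI/eqP.
rewrite subr_eq0 => /eqP <-.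
exact: p0.
Qed.

(** The polynomial e^2 - p^2 is nonnegative on the spectrum, and <p^2(A) x, x> is
|p(A) x|^2. *)
Lemma op_horner_bound (p : {poly R}) A e :
  symmetric_op A -> real_spectrum A ->
  (forall s, spectrum A s%:C -> `|p.[s]| <= e) ->
  forall x, rip (op_horner p A x) (op_horner p A x) <= e ^+ 2 * rip x x.
Proof.
move=> sA rA pe x.
have : 0 <= rip (op_horner ((e ^+ 2)%:P - p * p) A x) x.
  apply: op_horner_ge0 => // s As; rewrite !hornerE subr_ge0 -expr2.
  rewrite -(real_normK (num_real p.[s])) lerXn2r ?nnegrE ?pe//.
  by rewrite (le_trans _ (pe _ As)).
rewrite op_hornerB op_hornerC op_hornerM !bopE ripBl ripZl subr_ge0.
by rewrite symmetric_op_horner.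
Qed.

End PolynomialCalculus.

(** * The continuous functional calculus and the operator order *)

Lemma uniform_distP (R : realType) (S : set R) (u : nat -> R -> R) (f : R -> R) :
  {uniform S, u @ \oo --> f} <->
  forall e, 0 < e -> \forall n \near \oo, forall s, S s -> `|f s - u n s| < e.
Proof.
split=> [uf e e0|uf P /uniform_nbhs[E [entE EP]]].
  have : nbhs (f : {uniform` S -> R}) [set h | forall s, S s -> `|f s - h s| < e].
    apply/uniform_nbhs; exists [set xy | ball xy.1 e xy.2]; split=> //.
    exact: entourage_ball (PosNum e0).
  by move/uf.
have [e /= e0 eE] : exists2 e, 0 < e & [set xy : R * R | ball xy.1 e xy.2] `<=` E.
  by move: entE; rewrite -entourage_from_ballE => -[e e0 eE]; exists e.
apply: filterS (uf _ e0) => n un; apply: EP => s Ss.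
by apply: eE; exact: un.
Qed.

Section FunctionalCalculus.
Context {R : realType} {H : hilbertType R}.
Implicit Types (A B C : bop H) (x y : H) (f g : R -> R).

Lemma opnorm_ge0 A : 0 <= opnorm A.
Proof.
rewrite /opnorm; apply: lb_le_inf => [|c []//].
have [c c0 cA] := bounded_linear_ge0 (bop_funP A).
by exists c; split.
Qed.

Lemma opnorm_le A c : 0 <= c -> (forall x, rip (A x) (A x) <= c ^+ 2 * rip x x) ->
  opnorm A <= c.
Proof.
move=> c0 cA; apply: ge_inf; first by exists 0 => ? [].
by split=> // x; rewrite le_norm.
Qed.

Lemma opnorm_lt A e x : opnorm A < e -> rip (A x) (A x) <= e ^+ 2 * rip x x.
Proof.
have [c c0 cA] := bounded_linear_ge0 (bop_funP A).
move=> /inf_lt[|d [d0 dA] de]; first by exists c; split.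
have := dA x; rewrite le_norm// => h; rewrite (le_trans h)//.
by rewrite ler_wpM2r ?rip_ge0// lerXn2r ?nnegrE ?(ltW de)// (le_trans d0)// ltW.
Qed.

Lemma cvg_opnorm (T : nat -> bop H) B x :
  opnorm (T n - B) @[n --> \oo] --> (0 : R) -> T n x @[n --> \oo] --> B x.
Proof.
move=> TB; apply/cvgrPdist_le => e e0.
have eE : e = (complex.Re e)%:C by rewrite RRe_real// gtr0_real.
have re0 : 0 < complex.Re e by rewrite -ltcR -eE.
set k := Num.sqrt (rip x x).
have k0 : 0 <= k by exact: sqrtr_ge0.
have d0 : 0 < complex.Re e / (k + 1) by rewrite divr_gt0// ltr_wpDl.
have /cvgrPdist_lt/(_ _ d0) := TB; apply: filterS => n.
rewrite sub0r normrN ger0_norm ?opnorm_ge0// => /(@opnorm_lt _ _ x) h.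
rewrite distrC -[T n x - B x]/((T n - B) x) norm_sqrt eE lecR.
rewrite -(ler_pXn2r (_ : 0 < 2)%N) ?nnegrE ?sqrtr_ge0 ?(ltW re0)//.
rewrite sqr_sqrtr ?rip_ge0// (le_trans h)//.
rewrite -[rip x x]sqr_sqrtr ?rip_ge0// -/k -exprMn lerXn2r ?nnegrE ?(ltW re0)//.
  by rewrite mulr_ge0// ltW.
by rewrite mulrAC ler_pdivrMr ?ltr_wpDl// ler_wpM2l ?(ltW re0)// lerDl.
Qed.

Lemma is_fcalc_cvg A f B : is_fcalc A f B -> exists p : nat -> {poly R},
  (forall e, 0 < e -> \forall n \near \oo, forall s, spectrum A s%:C ->
     `|f s - (p n).[s]| < e) /\
  forall x, op_horner (p n) A x @[n --> \oo] --> B x.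
Proof.
move=> [p [/uniform_distP pf pB]]; exists p; split=> // x.
exact: cvg_opnorm.
Qed.

Lemma fcalc_symmetric A f B : symmetric_op A -> is_fcalc A f B -> symmetric_op B.
Proof.
move=> sA /is_fcalc_cvg[p [_ pB]] x y.
have e1 := @cvg_rip _ _ _ _ y (pB x).
have e2 : rip (op_horner (p n) A x) y @[n --> \oo] --> rip x (B y).
  under eq_fun do rewrite symmetric_op_horner// ripC.
  by rewrite ripC; exact: cvg_rip (pB y).
have E := cvg_unique (@norm_hausdorff _ _) e1 e2; exact: E.
Qed.

(** For approximating polynomials p_n of f and q_n of g, the polynomial
q_n - p_n + e is eventually nonnegative on the spectrum; let n grow, then e
decrease to 0.  With f = g this shows that f(A) is unique. *)
Lemma fcalc_le A f g B C : symmetric_op A -> real_spectrum A ->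
  is_fcalc A f B -> is_fcalc A g C ->
  (forall s, spectrum A s%:C -> f s <= g s) -> op_le B C.
Proof.
move=> sA rA fB gC fg; apply/op_posP; split.
  apply: symmetric_opD; first exact: fcalc_symmetric sA gC.
  exact: symmetric_opN (fcalc_symmetric sA fB).
move=> x; rewrite bopD bopN ripBl.
have [p [pf pB]] := is_fcalc_cvg fB; have [q [qg qC]] := is_fcalc_cvg gC.
have pq e : 0 < e -> 0 <= rip (C x) x - rip (B x) x + e * rip x x.
  move=> e0; have e2 : 0 < e / 2 by rewrite divr_gt0.
  have : rip (op_horner (q n) A x) x - rip (op_horner (p n) A x) x + e * rip x x
      @[n --> \oo] --> rip (C x) x - rip (B x) x + e * rip x x.
    by apply: cvgD; [apply: cvgB; exact: cvg_rip|exact: cvg_cst].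
  move/cvgr_to_ge; apply; near=> n.
  have : 0 <= rip (op_horner (q n - p n + e%:P) A x) x.
    apply: op_horner_ge0 => // s As; rewrite !hornerE.
    have : `|f s - (p n).[s]| < e / 2 by move: s As; near: n; exact: pf.
    have : `|g s - (q n).[s]| < e / 2 by move: s As; near: n; exact: qg.
    have := fg _ As; rewrite !ltr_norml => h /andP[h1 h2] /andP[h3 h4]; lra.
  by rewrite op_hornerD op_hornerB op_hornerC !bopE ripDl ripBl ripZl.
rewrite leNgt; apply/negP => neg.
have := rip_ge0 x; rewrite le_eqVlt => /predU1P[x0|x0].
  by move: neg; rewrite (rip_eq0 (esym x0)) !rip0r subrr ltxx.
have e0 : 0 < - (rip (C x) x - rip (B x) x) / 2 / rip x x.
  by rewrite !divr_gt0// oppr_gt0.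
by have := pq _ e0; rewrite divfK ?gt_eqF//; lra.
Unshelve. all: by end_near. Qed.

Lemma is_fcalc_horner A (p : {poly R}) : is_fcalc A (horner p) (op_horner p A).
Proof.
exists (fun=> p); split.
  by apply/uniform_distP => e e0; apply: nearW => n s _; rewrite subrr normr0.
under eq_fun do rewrite subrr.
suff -> : opnorm (0 : bop H) = 0 by exact: cvg_cst.
apply/eqP; rewrite eq_le opnorm_ge0 andbT opnorm_le// => x.
by rewrite expr0n mul0r rip0l.
Qed.

(** The easy half of the spectral mapping theorem: q(A) - q(s) is a multiple of
A - s by an operator commuting with it. *)
Lemma spectrum_horner A (q : {poly R}) s : spectrum A s%:C ->
  spectrum (op_horner q A) q.[s]%:C.
Proof.
move=> As invq; apply: As; rewrite -/(invertible_op _).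
have /factor_theorem[r rE] : root (q - q.[s]%:P) s by rewrite /root !hornerE subrr.
have XE : op_horner ('X - s%:P) A = A - s%:C *: (1 : bop H).
  by rewrite op_hornerB op_hornerX op_hornerC.
apply: (@invertible_op_comm _ _ _ (op_horner r A)).
  by rewrite -XE -!op_hornerM mulrC.
rewrite -XE -op_hornerM mulrC -rE op_hornerB op_hornerC.
exact: invq.
Qed.

Lemma is_fcalc_comp A (q : {poly R}) f B :
  is_fcalc (op_horner q A) f B -> is_fcalc A (fun s => f q.[s]) B.
Proof.
move=> [p [/uniform_distP pf pB]]; exists (fun n => p n \Po q); split.
  apply/uniform_distP => e e0; apply: filterS (pf _ e0) => n pn s As.
  by rewrite horner_comp; apply: pn; exact: spectrum_horner.
by under eq_fun do rewrite op_horner_comp.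
Qed.

(** By [op_horner_bound], polynomials that approximate f uniformly on the spectrum
give a Cauchy sequence of operators.  The limit is taken pointwise; it is
bounded, and a limit in norm, because the Cauchy estimate is proportional to the
norm of the vector and survives the passage to the limit. *)
Lemma fcalc_existence A f : symmetric_op A -> real_spectrum A ->
  (forall e, 0 < e -> exists p : {poly R}, forall s, spectrum A s%:C ->
     `|p.[s] - f s| <= e) ->
  is_fcalc A f (fcalc f A).
Proof.
move=> sA rA fA; suff [B fB] : exists B, is_fcalc A f B.
  exact: (xgetPex 0 (ex_intro _ B fB)).
have pe (n : nat) : exists p : {poly R}, forall s, spectrum A s%:C ->
    `|p.[s] - f s| <= n.+1%:R^-1 by apply: fA; rewrite invr_gt0.
have [p pf] : exists p : nat -> {poly R}, forall n s, spectrum A s%:C ->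
    `|(p n).[s] - f s| <= n.+1%:R^-1.
  by exists (fun n => projT1 (cid (pe n))) => n; case: cid.
have small (d : R) : 0 < d ->
    exists N : nat, forall n, (N <= n)%N -> 2 / n.+1%:R <= d.
  move=> d0; exists (Num.truncn (2 / d)) => n Nn.
  rewrite ler_pdivrMr// mulrC -ler_pdivrMr// ltW// (lt_le_trans (truncnS_gt _))//.
  by rewrite ler_nat.
have pd N n m x : (N <= n)%N -> (N <= m)%N ->
    rip (op_horner (p n) A x - op_horner (p m) A x)
        (op_horner (p n) A x - op_horner (p m) A x) <= (2 / N.+1%:R) ^+ 2 * rip x x.
  move=> Nn Nm; have := @op_horner_bound _ _ (p n - p m) A (2 / N.+1%:R) sA rA.
  rewrite op_hornerB; apply => s As.
  have le_inv (k : nat) : (N <= k)%N -> k.+1%:R^-1 <= N.+1%:R^-1 :> R.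
    by move=> Nk; rewrite lef_pV2 ?posrE// ler_nat.
  have := le_trans (pf n s As) (le_inv _ Nn).
  have := le_trans (pf m s As) (le_inv _ Nm).
  rewrite hornerD hornerN; move: N.+1%:R^-1 => d.
  by rewrite !ler_norml => /andP[? ?] /andP[? ?]; apply/andP; split; lra.
have lim_ex x : exists l : H, op_horner (p n) A x @[n --> \oo] --> l.
  apply: hilbert_cauchy => e e0.
  have k1 : 0 < rip x x + 1 by rewrite ltr_wpDl ?rip_ge0.
  have d0 : 0 < Num.sqrt (e / (rip x x + 1)) by rewrite sqrtr_gt0 divr_gt0.
  have [N NE] := small _ d0; exists N => n m Nn Nm.
  rewrite (le_trans (pd _ _ _ _ Nn Nm))//.
  rewrite (@le_trans _ _ (e / (rip x x + 1) * rip x x))//.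
    rewrite ler_wpM2r ?rip_ge0// -[leRHS]sqr_sqrtr ?divr_ge0 ?(ltW e0) ?(ltW k1)//.
    by rewrite lerXn2r ?nnegrE ?sqrtr_ge0 ?divr_ge0// NE.
  by rewrite mulrAC ler_pdivrMr// ler_wpM2l ?(ltW e0)// lerDl.
have [g gE] : exists g : H -> H, forall x, op_horner (p n) A x @[n --> \oo] --> g x.
  by exists (fun x => projT1 (cid (lim_ex x))) => x; case: cid.
have lg : linear g.
  move=> a x y.
  have e1 : op_horner (p n) A (a *: x + y) @[n --> \oo] --> a *: g x + g y.
    under eq_fun do rewrite bopxD bopxZ.
    by apply: cvgD; [apply: cvgZl_tmp; exact: gE|exact: gE].
  have E := cvg_unique (@norm_hausdorff _ _) (gE (a *: x + y)) e1; exact: E.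
have gp n x : rip (op_horner (p n) A x - g x) (op_horner (p n) A x - g x) <=
    (2 / n.+1%:R) ^+ 2 * rip x x.
  apply: (@cvg_rip_le _ _ (fun m => op_horner (p n) A x - op_horner (p m) A x)).
    by apply: cvgB; [exact: cvg_cst|exact: gE].
  by exists n => // m /= nm; exact: pd.
have [c _ [c0 cp]] := bop_bound (op_horner (p 0%N) A) 0.
have [B BE] : exists B : bop H, forall x, B x = g x.
  (* Compare g with the first polynomial, which is bounded by c. *)
  apply: (@bop_of_fun _ _ g (2 * c + 4)) => //; first by lra.
  move=> x; have := gp 0%N x; have := cp x; rewrite divr1.
  set u := op_horner _ _ x => h1 h2.
  have := @rip_convex _ _ 2^-1 u (g x - u); rewrite addrC subrK.
  rewrite -(opprB u) ripNl ripNr opprK => /(_ _)h3.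
  have := rip_ge0 x; have : 0 <= c * rip x x by rewrite mulr_ge0 ?rip_ge0 ?(ltW c0).
  have h4 : rip (g x) (g x) <=
      2^-1^-1 * rip u u + (1 - 2^-1)^-1 * rip (u - g x) (u - g x).
    by apply: h3; apply/andP; split; lra.
  have -> : (2 * c + 4) ^+ 2 * rip x x =
      4 * (c ^+ 2 * rip x x) + 16 * (c * rip x x) + 16 * rip x x by ring.
  have : (1 - 2^-1)^-1 = 2 :> R by field.
  move: h4; rewrite invrK => + e1; rewrite e1.
  by move: h1 h2 (sqr_ge0 c) (rip_ge0 u); lra.
exists B, p; split.
  apply/uniform_distP => e e0.
  have [N NE] := small _ e0; exists N => // n /= Nn s As.
  rewrite distrC (le_lt_trans (pf _ _ As))// (lt_le_trans _ (NE _ Nn))//.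
  by rewrite ltr_pMl ?invr_gt0// ltr1n.
apply/cvgrPdist_le => e e0; have [N NE] := small _ e0; exists N => // n /= Nn.
rewrite sub0r normrN ger0_norm ?opnorm_ge0//.
rewrite (le_trans _ (NE _ Nn))// opnorm_le// ?divr_ge0// => x.
by rewrite bopD bopN BE; exact: gp.
Qed.

Lemma fcalc_interval A f a b : symmetric_op A -> a < b ->
  spectrum A `<=` [set s%:C | s in `[a, b]] ->
  {within `[a, b], continuous f} -> is_fcalc A f (fcalc f A).
Proof.
move=> sA ab Aab cf; apply: fcalc_existence => //.
  by move=> z /Aab[s _ <-]; exists s.
move=> e e0; have [p pf] := weierstrass ab e0 cf.
exists p => s /Aab[s' s'ab /complexI <-]; exact: pf.
Qed.

End FunctionalCalculus.

(** * Positive maps, chords and maxima *)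

Section OrderAndMaps.
Context {R : realType} {H K : hilbertType R}.
Implicit Types (A B C : bop H) (r : R).

Lemma op_le_trans A B C : op_le A B -> op_le B C -> op_le A C.
Proof.
move=> AB BC x; have -> : (C - A) x = (C - B) x + (B - A) x.
  by rewrite -bopD addrA subrK.
by rewrite linearDl; apply: addr_ge0; [exact: BC|exact: AB].
Qed.

Lemma positive_map_le (Phi : {linear bop H -> bop K}) A B :
  positive_map Phi -> op_le A B -> op_le (Phi A) (Phi B).
Proof. by move=> pPhi AB; rewrite /op_le -raddfB; exact: pPhi. Qed.

Lemma opnormZ_le r A e : opnorm A < e -> opnorm (r%:C *: A) <= `|r| * e.
Proof.
move=> Ae; have e0 : 0 <= e by rewrite (le_trans (opnorm_ge0 A))// ltW.
rewrite opnorm_le ?mulr_ge0// => x.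
rewrite bopZ ripZl ripZr mulrA -expr2 exprMn real_normK ?num_real// -[leRHS]mulrA.
by rewrite ler_wpM2l ?sqr_ge0// opnorm_lt.
Qed.

Lemma is_fcalc_affine A (f : R -> R) B (a b : R) : is_fcalc A f B ->
  is_fcalc A (fun s => b + a * f s) (b%:C *: (1 : bop H) + a%:C *: B).
Proof.
move=> [p [/uniform_distP pf /cvgrPdist_lt pB]].
have a1 : 0 < `|a| + 1 by rewrite ltr_wpDl.
exists (fun n => b%:P + a%:P * p n); split.
  apply/uniform_distP => e e0.
  apply: filterS (pf _ (divr_gt0 e0 a1)) => n pn s As.
  rewrite !hornerE opprD addrACA subrr add0r -mulrBr normrM.
  have := pn _ As; rewrite ltr_pdivlMr// mulrC; apply: le_lt_trans.
  by rewrite ler_wpM2r// lerDl.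
apply/cvgrPdist_le => e e0; apply: filterS (pB _ (divr_gt0 e0 a1)) => n.
rewrite ![`|0 - _|]distrC !subr0 !(ger0_norm (opnorm_ge0 _)) => pn.
have -> : op_horner (b%:P + a%:P * p n) A - (b%:C *: (1 : bop H) + a%:C *: B) =
    a%:C *: (op_horner (p n) A - B).
  rewrite op_hornerD op_hornerM !op_hornerC -scale_bopAl mul1r opprD addrACA.
  by rewrite subrr add0r scalerBr.
rewrite (le_trans (opnormZ_le _ pn))// mulrA ler_pdivrMr// mulrC.
by rewrite ler_wpM2l ?(ltW e0)// lerDl.
Qed.

Lemma op_horner_spectrum A (p : {poly R}) (lo hi : R) :
  symmetric_op A -> real_spectrum A ->
  (forall s, spectrum A s%:C -> lo <= p.[s] <= hi) ->
  spectrum (op_horner p A) `<=` [set s%:C | s in `[lo, hi]].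
Proof.
move=> sA rA p_in.
apply: spectrum_bounds (symmetric_op_horner p sA) _ => x; apply/andP; split.
  have := @op_horner_ge0 _ _ (p - lo%:P) A sA rA _ x.
  rewrite op_hornerB op_hornerC !bopE ripBl ripZl subr_ge0; apply => s /p_in.
  by rewrite hornerD hornerN hornerC subr_ge0 => /andP[].
have := @op_horner_ge0 _ _ (hi%:P - p) A sA rA _ x.
rewrite op_hornerB op_hornerC !bopE ripBl ripZl subr_ge0; apply => s /p_in.
by rewrite hornerD hornerN hornerC subr_ge0 => /andP[].
Qed.

Lemma op_horner_affine A (a b : R) :
  op_horner (a%:P * 'X + b%:P) A = a%:C *: A + b%:C *: (1 : bop H).
Proof.
by rewrite op_hornerD op_hornerM !op_hornerC op_hornerX -scale_bopAl mul1r.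
Qed.

(** Positivity of A - m and M - A passes to Phi(A) - m and M - Phi(A); the first of
these makes Phi(A) symmetric, and the two together confine its spectrum. *)
Lemma positive_map_spectrum (Phi : {linear bop H -> bop K}) A (m M : R) :
  positive_map Phi -> unital_map Phi -> symmetric_op A ->
  spectrum A `<=` [set s%:C | s in `[m, M]] ->
  symmetric_op (Phi A) /\ spectrum (Phi A) `<=` [set s%:C | s in `[m, M]].
Proof.
move=> Phi_pos Phi_unital sA A_spec.
have rA : real_spectrum A by move=> z /A_spec[s _ <-]; exists s.
have A_in s : spectrum A s%:C -> s \in `[m, M].
  by move=> /A_spec[s' ? /complexI <-].
have posm : op_pos (Phi A - m%:C *: (1 : bop K)).
  rewrite -Phi_unital -linearZ -linearB; apply: Phi_pos; apply/op_posP.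
  split=> [|x]; first exact: symmetric_shift.
  rewrite rip_shift subr_ge0; apply: spectrum_ge => // s /A_in.
  by rewrite in_itv/= => /andP[].
have posM : op_pos (M%:C *: (1 : bop K) - Phi A).
  rewrite -Phi_unital -linearZ -linearB; apply: Phi_pos; apply/op_posP.
  split=> [|x].
    apply: symmetric_opD (symmetric_opN sA); apply: symmetric_opZ.
    exact: symmetric_op1.
  have := @op_horner_ge0 _ _ (M%:P - 'X) A sA rA _ x.
  rewrite op_hornerB op_hornerC op_hornerX; apply => s /A_in.
  by rewrite !hornerE in_itv/= subr_ge0 => /andP[].
have sPA : symmetric_op (Phi A).
  rewrite -[Phi A](subrK (m%:C *: (1 : bop K))); apply: symmetric_opD.
    by have /op_posP[] := posm.
  by apply: symmetric_opZ; exact: symmetric_op1.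
split=> //; apply: spectrum_bounds sPA _ => x; apply/andP; split.
  by have /op_posP[_ /(_ x)] := posm; rewrite rip_shift subr_ge0.
by have /op_posP[_ /(_ x)] := posM; rewrite !bopE ripBl ripZl subr_ge0.
Qed.

End OrderAndMaps.

Section Chord.
Local Open Scope convex_scope.
Context {R : realType}.
Implicit Types (f : R -> R) (m M s : R).

(** The affine function of s with values u at m and v at M. *)
Definition chord m M (u v : R) s := (M - s) / (M - m) * u + (s - m) / (M - m) * v.

(** The same weight l works for all end values u, v: this turns the chord of a
function and the point s itself into convex combinations at once. *)
Lemma chordP m M s : m < M -> s \in `[m, M] ->
  exists l : {i01 R}, forall u v : R^o, chord m M u v s = u <| l |> v.
Proof.
move=> mM; rewrite in_itv/= => /andP[ms sM].
have Mm : 0 < M - m by rewrite subr_gt0.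
have l0 : 0 <= (M - s) / (M - m) by rewrite divr_ge0 ?subr_ge0// ltW.
have l1 : (M - s) / (M - m) <= 1 by rewrite ler_pdivrMr// mul1r lerB.
exists (Itv01 l0 l1) => u v; rewrite convRE/= /chord /unstable.onem.
by congr (_ + _ * _); field; rewrite gt_eqF.
Qed.

Lemma convex_le_chord m M s f : m < M -> s \in `[m, M] ->
  convex_function (`[m, M] : set R^o) f -> f s <= chord m M (f m) (f M) s.
Proof.
move=> mM sab cf; have [l lE] := chordP mM sab.
have sE : (m : R^o) <| l |> M = s.
  by rewrite -lE /chord; field; rewrite subr_eq0 gt_eqF.
have := cf l m M; rewrite !inE/= !in_itv/= !lexx (ltW mM) => /(_ isT isT) fl.
by rewrite (lE (f m) (f M)) -[in leLHS]sE; exact: fl.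
Qed.

Lemma powR_chord m M s (u v p : R) : m < M -> s \in `[m, M] -> 0 <= u -> 0 <= v ->
  1 <= p -> chord m M u v s `^ p <= chord m M (u `^ p) (v `^ p) s.
Proof.
move=> mM sab u0 v0 p1; have [l lE] := chordP mM sab; rewrite !lE.
by apply: (convex_powR p1); rewrite inE/= in_itv/= andbT.
Qed.

Lemma chord_affine m M u v s : m < M ->
  chord m M u v s = (v - u) / (M - m) * s + (M * u - m * v) / (M - m).
Proof. by move=> mM; rewrite /chord; field; rewrite subr_eq0 gt_eqF. Qed.

Lemma chord_bounds m M (u v lo hi : R) s : m < M -> s \in `[m, M] ->
  lo <= u <= hi -> lo <= v <= hi -> lo <= chord m M u v s <= hi.
Proof.
move=> mM sI /andP[lou uhi] /andP[lov vhi].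
have Elo : lo = chord m M lo lo s.
  by rewrite /chord; field; rewrite subr_eq0 gt_eqF.
have Ehi : hi = chord m M hi hi s.
  by rewrite /chord; field; rewrite subr_eq0 gt_eqF.
move: sI; rewrite in_itv/= => /andP[ms sM].
have w0 : 0 <= (M - s) / (M - m) by rewrite divr_ge0 ?subr_ge0// ltW.
have w1 : 0 <= (s - m) / (M - m) by rewrite divr_ge0 ?subr_ge0// ltW.
by apply/andP; split; [rewrite {1}Elo|rewrite [leRHS]Ehi]; apply: lerD;
  exact: ler_wpM2l.
Qed.

(** The maximum is attained by compactness, so [set_max] returns it. *)
Lemma set_max_ge (m M : R) f s : m <= M -> {within `[m, M], continuous f} ->
  s \in `[m, M] -> f s <= set_max [set f s | s in `[m, M]].
Proof.
move=> mM cf sab; have [c cab cmax] := EVT_max mM cf.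
have [_] : ([set f s | s in `[m, M]] `&` ubound [set f s | s in `[m, M]])
   (set_max [set f s | s in `[m, M]]).
  by apply: getPex; exists (f c); split; [exists c|move=> _ [z zab <-]; exact: cmax].
by apply; exists s.
Qed.

Lemma continuous_affineB (m M a b alpha : R) f :
  {within `[m, M], continuous f} ->
  {within `[m, M], continuous (fun s => a * s + b - alpha * f s)}.
Proof.
move=> /subspace_continuousP cf; apply/subspace_continuousP => x xI.
apply: cvgB; last by apply: cvgMl_tmp; exact: cf.
by apply: cvgD; [apply: cvgMl_tmp; exact: cvg_within|exact: cvg_cst].
Qed.

Lemma continuous_powR_within (a b p : R) : 0 < a ->
  {within `[a, b], continuous (fun s : R => s `^ p)}.
Proof.
move=> a0; apply: continuous_in_subspaceT => s; rewrite inE/= in_itv/=.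
move=> /andP[as_ _].
apply: differentiable_continuous; apply/derivable1_diffP; apply: derivable_powR.
by rewrite in_itv/= andbT (lt_le_trans a0).
Qed.

End Chord.

(** * The operator inequalities *)

Theorem theorem2p3 (R : realType) (H K : hilbertType R) (m M : R)
    (A : bop H) (Phi : {linear bop H -> bop K}) (t : R) (f : R -> R)
    (ltmM : m < M)
    (A_sa : self_adjoint A)
    (A_spec : spectrum A `<=` [set s%:C | s in `[m, M]])
    (Phi_pos : positive_map Phi)
    (Phi_unital : unital_map Phi)
    (t_gt0 : 0 < t) (t_lt1 : t < 1)
    (f_gt0 : forall s, s \in `[m, M] -> 0 < f s)
    (f_cont : {within `[m, M], continuous f})
    (ft_convex : convex_function (`[m, M] : set R^o) (fun s => f s `^ t))
    (alpha : R) :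
  let a_f := (f M - f m) / (M - m) in
  let b_f := (M * f m - m * f M) / (M - m) in
  let beta := set_max [set a_f * s + b_f - alpha * f s | s in `[m, M]] in
  let L := (f m `^ t / (M - m))%:C *: (M%:C *: (1 : bop H) - A)
         + (f M `^ t / (M - m))%:C *: (A - m%:C *: (1 : bop H)) in
  op_le (Phi (fcalc f A)) (Phi (fcalc (fun s => s `^ t^-1) L)) /\
  op_le (Phi (fcalc (fun s => s `^ t^-1) L))
        (beta%:C *: (1 : bop K) + alpha%:C *: fcalc f (Phi A)).
Proof.
move=> a_f b_f beta L.
have mI : m \in `[m, M] by rewrite in_itv/= lexx ltW.
have MI : M \in `[m, M] by rewrite in_itv/= lexx ltW.
have [fm0 fM0] := (f_gt0 _ mI, f_gt0 _ MI).
have Mm : 0 < M - m by rewrite subr_gt0.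
have sA : symmetric_op A by exact/self_adjointP.
have rA : real_spectrum A by move=> z /A_spec[s _ <-]; exists s.
have A_in s : spectrum A s%:C -> s \in `[m, M] by move=> /A_spec[s' ? /complexI <-].
pose u := f m `^ t; pose v := f M `^ t.
have u0 : 0 < u by exact: powR_gt0.
have v0 : 0 < v by exact: powR_gt0.
(* L is q(A), where q is the affine function l written as a polynomial. *)
pose l := chord m M u v.
pose q : {poly R} := (u / (M - m))%:P * (M%:P - 'X) + (v / (M - m))%:P * ('X - m%:P).
have ql s : q.[s] = l s.
  by rewrite /q /l /chord !hornerE; field; rewrite gt_eqF.
have LE : L = op_horner q A.
  by rewrite /q op_hornerD !op_hornerM !op_hornerB !op_hornerC op_hornerX
    -!scale_bopAl !mul1r.
have sL : symmetric_op L by rewrite LE; exact: symmetric_op_horner.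
(* The end hi is shifted by 1 so that the segment is not degenerate when f takes
   the same value at m and M. *)
pose lo := Num.min u v; pose hi := Num.max u v + 1.
have lo0 : 0 < lo by rewrite /lo lt_min u0.
have lohi : lo < hi.
  by rewrite /lo /hi (@le_lt_trans _ _ (Num.max u v)) ?ltrDl// le_max ge_min lexx.
have ulo : lo <= u <= hi.
  apply/andP; split; first by rewrite ge_min lexx.
  by rewrite (@le_trans _ _ (Num.max u v)) ?lerDl// le_max lexx.
have vlo : lo <= v <= hi.
  apply/andP; split; first by rewrite ge_min lexx orbT.
  by rewrite (@le_trans _ _ (Num.max u v)) ?lerDl// le_max lexx orbT.
have l_bounds s : s \in `[m, M] -> lo <= l s <= hi.
  by move=> sI; exact: chord_bounds.
have L_spec : spectrum L `<=` [set s%:C | s in `[lo, hi]].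
  rewrite LE; apply: op_horner_spectrum => // s /A_in/l_bounds.
  by rewrite ql.
have calc_f := fcalc_interval sA ltmM A_spec f_cont.
have calc_l : is_fcalc A (fun s => l s `^ t^-1) (fcalc (fun s => s `^ t^-1) L).
  have := fcalc_interval sL lohi L_spec (@continuous_powR_within _ lo hi t^-1 lo0).
  rewrite {1}LE => /is_fcalc_comp; congr is_fcalc.
  by apply/funext => s; rewrite ql.
have powK y : 0 < y -> (y `^ t) `^ t^-1 = y.
  by move=> y0; rewrite -powRrM divff ?gt_eqF// powRr1// ltW.
split.
  apply: positive_map_le => //; apply: fcalc_le calc_f calc_l _ => // s /A_in sI.
  rewrite -[leLHS]powK ?f_gt0// ge0_ler_powR//.
  - by rewrite invr_ge0 ltW.
  - by rewrite nnegrE powR_ge0.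
  - by have /andP[lol _] := l_bounds _ sI; rewrite nnegrE (le_trans (ltW lo0)).
  exact: (convex_le_chord ltmM sI ft_convex).
pose c : {poly R} := a_f%:P * 'X + b_f%:P.
have cE s : c.[s] = a_f * s + b_f by rewrite /c !hornerE.
have lc : op_le (fcalc (fun s => s `^ t^-1) L) (op_horner c A).
  apply: fcalc_le calc_l (is_fcalc_horner A c) _ => // s /A_in sI.
  have t1 : 1 <= t^-1 by rewrite invf_ge1// ltW.
  rewrite cE (le_trans (powR_chord ltmM sI (ltW u0) (ltW v0) t1))//.
  by rewrite /u /v !powK// chord_affine.
apply: op_le_trans (positive_map_le Phi_pos lc) _.
have -> : Phi (op_horner c A) = op_horner c (Phi A).
  by rewrite !op_horner_affine linearD !linearZ/= Phi_unital.
have [sPA PA_spec] := positive_map_spectrum Phi_pos Phi_unital sA A_spec.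
have rPA : real_spectrum (Phi A) by move=> z /PA_spec[s _ <-]; exists s.
have calc_fPA :=
  is_fcalc_affine alpha beta (fcalc_interval sPA ltmM PA_spec f_cont).
apply: fcalc_le (is_fcalc_horner (Phi A) c) calc_fPA _ => // s.
move=> /PA_spec[s' sI /complexI <-]; rewrite cE -lerBlDr.
apply: (@set_max_ge _ m M (fun s => a_f * s + b_f - alpha * f s)) => //.
  exact: ltW.
exact: continuous_affineB.
Qed.
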